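(* Let $A\in\mathbb{R}^{n\times n}$, $B\in\mathbb{R}^{n\times p}$ and assume that $(A,B)$ is controllable. For $\lambda>0$ sufficiently large, define $$Q=\int_0^\infty e^{-2\lambda t}e^{-tA}BB^\top e^{-tA^\top}\,dt$$ (which is well defined and invertible) and set $P=Q^{-1}$. Then there exists $c>0$ such that every solution $x$ of the system $$x'=Ax+Bu\quad\text{where } u=-B^\top Px$$ satisfies $$\|x(t)\|\le c\,e^{-\lambda t}\|x(0)\|\quad\text{for all } t\ge 0.$$
   Context: The pair $(A,B)$ is controllable if, given $t_0<t_1$, for all $x_0,x_1\in\mathbb{R}^n$ there exists $u\in L^2((t_0,t_1);\mathbb{R}^p)$ such that the solution of $x'=Ax+Bu$ with $x(t_0)=x_0$ satisfies $x(t_1)=x_1$ (this does not depend on $t_0<t_1$; it is equivalent to $\operatorname{rank}[B,AB,\dots,A^{n-1}B]=n$). $\|\cdot\|$ is the Euclidean norm. *)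

(* Defs.v *)
From HB Require Import structures.
From mathcomp Require Import all_boot all_order all_algebra.
From mathcomp Require Import all_classical all_reals all_analysis.

Set Implicit Arguments.
Unset Strict Implicit.
Unset Printing Implicit Defensive.

Import Order.TTheory GRing.Theory Num.Theory.
Import numFieldNormedType.Exports.

Local Open Scope classical_set_scope.
Local Open Scope ring_scope.

(* The library norm on matrices is the sup norm. *)
Definition enorm (R : realType) (n : nat) (v : 'cV[R]_n) : R :=
  Num.sqrt (\sum_(i < n) (v i 0) ^+ 2).

Definition expmx (R : realType) (n : nat) (X : 'M[R]_n) : 'M[R]_n :=
  limn (series (fun k : nat => (k`!%:R)^-1 *: X ^+ k)).

Definition mx_integrable (R : realType) (m n : nat) (D : set R)
    (F : R -> 'M[R]_(m, n)) : Prop :=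
  forall i j, lebesgue_measure.-integrable D (fun t => (F t i j)%:E).

Definition mx_integral (R : realType) (m n : nat) (D : set R)
    (F : R -> 'M[R]_(m, n)) : 'M[R]_(m, n) :=
  \matrix_(i, j) \int[lebesgue_measure]_(t in D) F t i j.

Definition L2_control (R : realType) (p : nat) (t0 t1 : R)
    (u : R -> 'cV[R]_p) : Prop :=
  forall j : 'I_p,
    measurable_fun `]t0, t1[ (fun t => u t j 0) /\
    lebesgue_measure.-integrable `]t0, t1[ (fun t => ((u t j 0) ^+ 2)%:E).

(* Solutions of x' = A x + B u for a merely L^2 control u are meant in the
   sense of Caratheodory, i.e. through the integrated equation. *)
Definition controlled_solution (R : realType) (n p : nat)
    (A : 'M[R]_n) (B : 'M[R]_(n, p)) (t0 t1 : R)
    (u : R -> 'cV[R]_p) (x : R -> 'cV[R]_n) : Prop :=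
  {within `[t0, t1], continuous x} /\
  forall t : R, t0 <= t <= t1 ->
    x t = x t0 + mx_integral `[t0, t] (fun s => A *m x s + B *m u s).

Definition controllable (R : realType) (n p : nat)
    (A : 'M[R]_n) (B : 'M[R]_(n, p)) (t0 t1 : R) : Prop :=
  forall x0 x1 : 'cV[R]_n,
    exists2 u : R -> 'cV[R]_p, L2_control t0 t1 u &
    exists x : R -> 'cV[R]_n,
      [/\ controlled_solution A B t0 t1 u x, x t0 = x0 & x t1 = x1].

Definition gramian_integrand (R : realType) (n p : nat)
    (A : 'M[R]_n) (B : 'M[R]_(n, p)) (lambda t : R) : 'M[R]_n :=
  expR (- 2 * lambda * t) *:
    (expmx (- t *: A) *m B *m B^T *m expmx (- t *: A^T)).

Definition gramian (R : realType) (n p : nat)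
    (A : 'M[R]_n) (B : 'M[R]_(n, p)) (lambda : R) : 'M[R]_n :=
  mx_integral `[0, +oo[ (gramian_integrand A B lambda).

(* Classical solutions on [0, +oo[ of x' = A x + B u with u = K x; the
   one-sided derivative at 0 is not required, only continuity. *)
Definition closed_loop_solution (R : realType) (n p : nat)
    (A : 'M[R]_n) (B : 'M[R]_(n, p)) (K : 'M[R]_(p, n))
    (x : R -> 'cV[R]_n) : Prop :=
  {within `[0, +oo[, continuous x} /\
  forall t : R, 0 < t -> is_derive t 1 x (A *m x t + B *m (K *m x t)).

(* Main.v *)
Require Import Defs.
From HB Require Import structures.
From mathcomp Require Import all_boot all_order all_algebra.
From mathcomp Require Import all_classical all_reals all_analysis.
From mathcomp Require Import measurable_realfun ring lra.

Set Implicit Arguments.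
Unset Strict Implicit.
Unset Printing Implicit Defensive.

Import Order.TTheory GRing.Theory Num.Theory.
Import numFieldNormedType.Exports.

Local Open Scope classical_set_scope.
Local Open Scope ring_scope.

(* Write [As = A + lambda] and [F t = e^{-2 lambda t} e^{-tA} B B^T e^{-tA^T}].
   For [lambda] above the entrywise l1 norm of [A], which bounds the growth rate
   of [e^{-tA}], [F] decays exponentially; integrating [F' = - (As F + F As^T)]
   over [0, +oo[ gives the Lyapunov equation [As Q + Q As^T = B B^T].  Since [Q]
   is symmetric, this equation makes the left kernel of [Q] invariant under [A]
   and orthogonal to the range of [B]; controllability then makes it zero.
   Finally [V x = x^T Q^-1 x] satisfies [V' <= - 2 lambda V] along the closed
   loop, and [|x|^2 <= tr Q * V x] by Cauchy-Schwarz. *)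

(** * The entrywise l1 norm of matrices *)

Section MatrixL1Norm.
Context {R : numDomainType}.

(** This norm is submultiplicative, invariant under transposition, and dominates both the entries
    and the quadratic form of a matrix. *)
Definition mxl1 (m n : nat) (X : 'M[R]_(m, n)) : R := \sum_i \sum_j `|X i j|.

Lemma mxl1_ge0 (m n : nat) (X : 'M[R]_(m, n)) : 0 <= mxl1 X.
Proof. by apply: sumr_ge0 => i _; apply: sumr_ge0. Qed.

Lemma row_le_mxl1 (m n : nat) (X : 'M[R]_(m, n)) i :
  \sum_j `|X i j| <= mxl1 X.
Proof.
rewrite /mxl1 (bigD1 i)//= lerDl; apply: sumr_ge0 => k _; exact: sumr_ge0.
Qed.

Lemma entry_le_mxl1 (m n : nat) (X : 'M[R]_(m, n)) i j : `|X i j| <= mxl1 X.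
Proof.
apply: le_trans (row_le_mxl1 X i).
by rewrite (bigD1 j)//= lerDl; apply: sumr_ge0.
Qed.

Lemma mxl1M (m n p : nat) (X : 'M[R]_(m, n)) (Y : 'M[R]_(n, p)) :
  mxl1 (X *m Y) <= mxl1 X * mxl1 Y.
Proof.
rewrite /mxl1 mulr_suml; apply: ler_sum => i _.
apply: (@le_trans _ _ (\sum_j \sum_k `|X i k| * `|Y k j|)).
  apply: ler_sum => j _; rewrite mxE; apply: le_trans (ler_norm_sum _ _ _) _.
  by apply: ler_sum => k _; rewrite normrM.
rewrite exchange_big/= mulr_suml; apply: ler_sum => k _.
by rewrite -mulr_sumr; apply: ler_wpM2l => //; exact: row_le_mxl1.
Qed.

Lemma mxl1D (m n : nat) (X Y : 'M[R]_(m, n)) : mxl1 (X + Y) <= mxl1 X + mxl1 Y.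
Proof.
rewrite /mxl1 -big_split; apply: ler_sum => i _ /=.
by rewrite -big_split; apply: ler_sum => j _; rewrite mxE ler_normD.
Qed.

Lemma mxl1Z (m n : nat) (a : R) (X : 'M[R]_(m, n)) :
  mxl1 (a *: X) = `|a| * mxl1 X.
Proof.
rewrite /mxl1 mulr_sumr; apply: eq_bigr => i _.
by rewrite mulr_sumr; apply: eq_bigr => j _; rewrite mxE normrM.
Qed.

Lemma mxl1N (m n : nat) (X : 'M[R]_(m, n)) : mxl1 (- X) = mxl1 X.
Proof. by apply: eq_bigr => i _; apply: eq_bigr => j _; rewrite mxE normrN. Qed.

Lemma mxl1_trmx (m n : nat) (X : 'M[R]_(m, n)) : mxl1 X^T = mxl1 X.
Proof.
rewrite /mxl1 exchange_big; apply: eq_bigr => i _.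
by apply: eq_bigr => j _; rewrite mxE.
Qed.

Lemma mxl1_le_const (m n : nat) (X : 'M[R]_(m, n)) (c : R) :
  (forall i j, `|X i j| <= c) -> mxl1 X <= (m * n)%:R * c.
Proof.
move=> Xc; apply: (@le_trans _ _ (\sum_(i < m) \sum_(j < n) c)).
  by apply: ler_sum => i _; apply: ler_sum.
by rewrite !big_const_ord !iter_addr_0 -mulrnA mulnC mulr_natl.
Qed.

(** The bound is on entries because the identity has l1 norm [n]: at [k = 0] the same bound on
    [mxl1 (X ^+ k)] would fail for [n > 1]. The induction expands one row of [X] against the entries
    of [X ^+ k]. *)
Lemma entryX_le_mxl1 (n : nat) (X : 'M[R]_n) k i j :
  `|(X ^+ k) i j| <= mxl1 X ^+ k.
Proof.
elim: k i j => [|k IH] i j.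
  by rewrite !expr0 mxE; case: eqP => _; rewrite ?normr1 ?normr0.
rewrite !exprS [X in `|X|]mxE; apply: le_trans (ler_norm_sum _ _ _) _.
apply: le_trans (ler_wpM2r _ (row_le_mxl1 X i)); last first.
  by rewrite exprn_ge0// mxl1_ge0.
rewrite mulr_suml; apply: ler_sum => l _.
by rewrite normrM; apply: ler_wpM2l.
Qed.

End MatrixL1Norm.

(** * The matrix exponential, entry by entry as a scalar power series *)

Lemma exprZmx (R : comPzRingType) (n : nat) (a : R) (X : 'M[R]_n) k :
  (a *: X) ^+ k = a ^+ k *: X ^+ k.
Proof.
elim: k => [|k IH]; first by rewrite !expr0 scale1r.
by rewrite !exprS IH -[LHS]/(_ *m _) -scalemxAl -scalemxAr scalerA.
Qed.

Lemma trmxX (R : comPzRingType) (n : nat) (X : 'M[R]_n) k :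
  (X ^+ k)^T = X^T ^+ k.
Proof.
elim: k => [|k IH]; first by rewrite !expr0 -[LHS]/((1%:M)^T) trmx1.
by rewrite exprS -[(_ * _)^T]/((_ *m _)^T) trmx_mul IH exprSr.
Qed.

Lemma cvg_mx (R : realFieldType) (m n : nat) (u : nat -> 'M[R]_(m, n))
    (l : 'M[R]_(m, n)) :
  (forall i j, (fun k => u k i j) @ \oo --> l i j) -> u @ \oo --> l.
Proof.
move=> ul; apply/cvgrPdist_le => /= e e0; near=> k.
rewrite /Num.Def.normr/= mx_normrE (bigmax_le _ (ltW e0))//= => i _.
rewrite !mxE/=; move: i; near: k; apply: filter_forall => /= i.
exact: ((cvgrPdist_le _ _).1 (ul i.1 i.2)).
Unshelve. all: by end_near. Qed.

Section MatrixExponential.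
Context {R : realType} {n : nat}.
Implicit Type X : 'M[R]_n.

Definition expmx_coef X i j (k : nat) : R := (k`!%:R)^-1 * (X ^+ k) i j.

(** Domination by the scalar exponential series yields both the absolute convergence of each entry
    and the growth bound [expmxZ_entry_le]. *)
Lemma expmx_coef_le X i j (t : R) k :
  `|expmx_coef X i j k * t ^+ k| <= exp_coeff (mxl1 X * `|t|) k.
Proof.
rewrite /exp_coeff/= /expmx_coef exprMn !normrM normfV normrX.
rewrite (ger0_norm (ler0n _ _)) -mulrA mulrC ler_wpM2r ?invr_ge0//.
by apply: ler_wpM2r (entryX_le_mxl1 _ _ _ _); exact: exprn_ge0.
Qed.

Lemma normed_expmx_coef_cvg X i j (t : R) :
  cvgn [normed pseries (expmx_coef X i j) t].
Proof.
apply: (@series_le_cvg _ _ (exp_coeff (mxl1 X * `|t|))).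
- by move=> k; exact: normr_ge0.
- by move=> k; apply: exp_coeff_ge0; rewrite mulr_ge0// mxl1_ge0.
- by move=> k; exact: expmx_coef_le.
- exact: is_cvg_series_exp_coeff.
Qed.

Lemma expmx_coef_cvg X i j (t : R) : cvgn (pseries (expmx_coef X i j) t).
Proof. exact/normed_cvg/normed_expmx_coef_cvg. Qed.

Lemma expmxZ_entry X (t : R) i j :
  expmx (t *: X) i j = limn (pseries (expmx_coef X i j) t).
Proof.
suff -> : expmx (t *: X) =
    \matrix_(i, j) limn (pseries (expmx_coef X i j) t) by rewrite mxE.
apply: cvg_lim => //; apply: cvg_mx => k l; rewrite mxE.
rewrite (_ : (fun _ => _) = pseries (expmx_coef X k l) t).
  exact: expmx_coef_cvg.
apply/funext => m; rewrite /series/= summxE; apply: eq_bigr => q _.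
by rewrite exprZmx !mxE /expmx_coef mulrCA mulrC.
Qed.

(** Since [(k+1) / (k+1)! = 1 / k!] and [X ^+ k.+1 = X * X ^+ k], this is the identity
    [(e^{tX})' = X e^{tX}] at the level of coefficients. *)
Lemma pseries_diffs_expmx_coef X i j :
  pseries_diffs (expmx_coef X i j) =
  (fun k => \sum_l X i l * expmx_coef X l j k).
Proof.
apply/funext => k; rewrite /pseries_diffs /expmx_coef factS natrM invfM.
rewrite exprS -mulrA mulVKf ?pnatr_eq0//.
by rewrite [X in _ * X]mxE mulr_sumr; apply: eq_bigr => l _; rewrite mulrCA.
Qed.

Lemma pseries_linear (c : 'I_n -> R) (f : 'I_n -> nat -> R) (t : R) :
  pseries (fun k => \sum_l c l * f l k) t =
  (fun k => \sum_l c l * pseries (f l) t k).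
Proof.
apply/funext => k; rewrite /pseries/series/=.
under eq_bigr do rewrite mulr_suml.
rewrite exchange_big; apply: eq_bigr => l _ /=.
by rewrite mulr_sumr; apply: eq_bigr => q _; rewrite mulrA.
Qed.

Lemma pseries_linear_cvg (c : 'I_n -> R) (f : 'I_n -> nat -> R) (t : R) :
  (forall l, cvgn (pseries (f l) t)) ->
  pseries (fun k => \sum_l c l * f l k) t @ \oo -->
    \sum_l c l * limn (pseries (f l) t).
Proof.
move=> fc; rewrite pseries_linear.
apply: cvg_big => [|l _]; first exact: add_continuous.
by apply: cvgM; [exact: cvg_cst|exact: fc].
Qed.

(** Differentiation term by term. The formal derivative is a finite combination of series of the
    same kind, so applying [pseries_diffs_expmx_coef] twice gives convergence of the first and
    second formal derivatives. *)
Lemma is_derive_expmxZ X (t : R) i j :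
  is_derive t 1 (fun s => expmx (s *: X) i j) ((X *m expmx (t *: X)) i j).
Proof.
rewrite [X in is_derive _ _ X](_ : _ =
  (fun s => limn (pseries (expmx_coef X i j) s))); last first.
  by apply/funext => s; exact: expmxZ_entry.
have dE s : pseries (pseries_diffs (expmx_coef X i j)) s @ \oo -->
    (X *m expmx (s *: X)) i j.
  rewrite pseries_diffs_expmx_coef mxE.
  under [X in _ --> X]eq_bigr do rewrite expmxZ_entry.
  by apply: pseries_linear_cvg => l; exact: expmx_coef_cvg.
rewrite -(cvg_lim _ (dE t))//.
(* Convergence is required at some point of modulus greater than that of [t]; the series converge
   everywhere, so [|t| + 1] will do. *)
apply: (@pseries_snd_diffs _ _ (`|t| + 1)).
- exact: expmx_coef_cvg.
- by apply/cvg_ex; eexists; exact: dE.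
- rewrite pseries_diffs_expmx_coef.
  rewrite (_ : pseries_diffs _ =
      (fun k => \sum_l X i l * pseries_diffs (expmx_coef X l j) k)).
    apply/cvg_ex; eexists; apply: pseries_linear_cvg => l.
    rewrite pseries_diffs_expmx_coef.
    apply/cvg_ex; eexists; apply: pseries_linear_cvg => k.
    exact: expmx_coef_cvg.
  apply/funext => k; rewrite /pseries_diffs mulr_sumr.
  by apply: eq_bigr => l _; rewrite mulrCA.
- by rewrite [ltRHS]ger0_norm ?ltrDl// addr_ge0.
Qed.

Lemma expmxZ_entry_le X (t : R) i j :
  `|expmx (t *: X) i j| <= expR (mxl1 X * `|t|).
Proof.
rewrite expmxZ_entry.
apply: (le_trans (@lim_series_norm _ R^o _ (@normed_expmx_coef_cvg X i j t))).
apply: lim_series_le.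
- exact: normed_expmx_coef_cvg.
- exact: is_cvg_series_exp_coeff.
- by move=> k; exact: expmx_coef_le.
Qed.

Lemma expmxZ_trmx X (t : R) : expmx (t *: X^T) = (expmx (t *: X))^T.
Proof.
apply/matrixP => i j; rewrite mxE !expmxZ_entry; congr (limn (pseries _ t)).
by apply/funext => k; rewrite /expmx_coef -trmxX mxE.
Qed.

Lemma expmx0 : expmx (0 : 'M[R]_n) = 1%:M.
Proof.
apply/matrixP => i j; rewrite -(scale0r (0 : 'M[R]_n)) expmxZ_entry.
(* The partial sum of index 0 is empty; after a shift by one the partial sums at 0 are constant. *)
apply: cvg_lim => //; rewrite -cvg_shiftS /=.
apply: cvg_near_cst; apply: nearW => k.
rewrite /pseries/series/= big_nat_recl//= big1 ?addr0; last first.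
  by move=> q _; rewrite expr0n mulr0.
by rewrite /expmx_coef fact0 invr1 !expr0 mul1r mulr1.
Qed.

End MatrixExponential.

(** * Entrywise derivatives of matrix-valued functions *)

Definition has_mxderive (R : realType) (m n : nat) (M : R -> 'M[R]_(m, n))
    (t : R) (D : 'M[R]_(m, n)) : Prop :=
  forall i j, is_derive t 1 (fun s => M s i j) (D i j).

Section MatrixDerivative.
Context {R : realType}.

Lemma has_mxderive_cst (m n : nat) (M : 'M[R]_(m, n)) (t : R) :
  has_mxderive (fun=> M) t 0.
Proof. by move=> i j; rewrite mxE; exact: is_derive_cst. Qed.

Lemma has_mxderiveM (m n p : nat) (M : R -> 'M[R]_(m, n))
    (N : R -> 'M[R]_(n, p)) (t : R) D D' :
  has_mxderive M t D -> has_mxderive N t D' ->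
  has_mxderive (fun s => M s *m N s) t (D *m N t + M t *m D').
Proof.
move=> MD ND i j.
have MND k : is_derive t 1 ((fun s => M s i k) * (fun s => N s k j))
    (M t i k * D' k j + N t k j * D i k).
  exact: is_deriveM.
rewrite [X in is_derive _ _ X](_ : _ =
    \sum_k ((fun s => M s i k) * (fun s => N s k j))); last first.
  by apply/funext => s; rewrite mxE fct_sumE.
have MN := is_derive_sum MND; apply: is_derive_eq.
rewrite !mxE -big_split/=; apply: eq_bigr => k _.
by rewrite addrC [N t k j * _]mulrC.
Qed.

Lemma has_mxderiveMl (m n p : nat) (M : 'M[R]_(m, n))
    (N : R -> 'M[R]_(n, p)) (t : R) D :
  has_mxderive N t D -> has_mxderive (fun s => M *m N s) t (M *m D).
Proof.
move=> ND; have := has_mxderiveM (has_mxderive_cst M t) ND.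
by rewrite mul0mx add0r.
Qed.

Lemma has_mxderiveMr (m n p : nat) (M : R -> 'M[R]_(m, n))
    (N : 'M[R]_(n, p)) (t : R) D :
  has_mxderive M t D -> has_mxderive (fun s => M s *m N) t (D *m N).
Proof.
move=> MD; have := has_mxderiveM MD (has_mxderive_cst N t).
by rewrite mulmx0 addr0.
Qed.

Lemma has_mxderiveD (m n : nat) (M N : R -> 'M[R]_(m, n)) (t : R) D D' :
  has_mxderive M t D -> has_mxderive N t D' ->
  has_mxderive (fun s => M s + N s) t (D + D').
Proof.
move=> MD ND i j; rewrite mxE.
rewrite (_ : (fun _ => _) = (fun s => M s i j) + (fun s => N s i j)).
  exact: is_deriveD.
by apply/funext => s; rewrite mxE.
Qed.

Lemma has_mxderive_tr (m n : nat) (M : R -> 'M[R]_(m, n)) (t : R) D :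
  has_mxderive M t D -> has_mxderive (fun s => (M s)^T) t D^T.
Proof.
move=> MD i j; rewrite mxE.
rewrite (_ : (fun _ => _) = (fun s => M s j i))//.
by apply/funext => s; rewrite mxE.
Qed.

Lemma has_mxderiveZ (m n : nat) (f : R -> R) (M : R -> 'M[R]_(m, n))
    (t df : R) D :
  is_derive t 1 f df -> has_mxderive M t D ->
  has_mxderive (fun s => f s *: M s) t (df *: M t + f t *: D).
Proof.
move=> fd MD i j.
rewrite (_ : (fun _ => _) = f * (fun s => M s i j)); last first.
  by apply/funext => s; rewrite mxE.
apply: is_derive_eq; first exact: is_deriveM.
by rewrite !mxE addrC [df * _]mulrC.
Qed.

(** Passage from the derivative in the normed space of matrices, in which closed-loop solutions are
    given, to the entrywise calculus. *)
Lemma has_mxderive_is_derive (m n : nat) (M : R -> 'M[R]_(m, n)) (t : R) D :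
  is_derive t 1 M D -> has_mxderive M t D.
Proof.
move=> [dM <-] i j; have /derivable_mxP/(_ i j) Mij := dM.
by rewrite derive_mx// mxE; exact: derivableP.
Qed.

Lemma has_mxderive_continuous (m n : nat) (M : R -> 'M[R]_(m, n))
    (t : R) D i j :
  has_mxderive M t D -> {for t, continuous (fun s => M s i j)}.
Proof.
move=> /(_ i j)[dM _].
exact/differentiable_continuous/derivable1_diffP.
Qed.

End MatrixDerivative.

(** * Scalar exponentials and a Gronwall inequality *)

Lemma is_derive_expR_lin (R : realType) (k t : R) :
  is_derive t 1 (fun s : R => expR (k * s)) (k * expR (k * t)).
Proof.
have lin : is_derive t 1 (fun s : R => k * s) k.
  rewrite (_ : (fun _ => _) = k *: (id : R -> R)); last by apply/funext.
  by apply: is_derive_eq; rewrite /GRing.scale/= mulr1.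
have := @is_derive1_comp R expR (fun s => k * s) t (expR (k * t)) k _ lin.
by rewrite [expR _ * k]mulrC; apply.
Qed.

Lemma continuous_expR_lin (R : realType) (k : R) :
  continuous (fun s : R => expR (k * s)).
Proof.
move=> t; have [d _] := is_derive_expR_lin k t.
exact/differentiable_continuous/derivable1_diffP.
Qed.

(** The function [V t * e^{-L t}] has nonpositive derivative inside the interval, so the mean value
    theorem makes its value at [b] at most that at [a]. It serves with [L >= 0] for uniqueness of a
    linear equation and with [L = - 2 * lambda] for decay. *)
Lemma gronwall_derive (R : realType) (V dV : R -> R) (L a b : R) :
  a <= b -> {within `[a, b], continuous V} ->
  (forall t, a < t < b -> is_derive t 1 V (dV t)) ->
  (forall t, a < t < b -> dV t <= L * V t) ->
  V b <= expR (L * (b - a)) * V a.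
Proof.
move=> ab Vc Vd dVle.
pose g := V * (fun s : R => expR (- L * s)).
pose dg t := V t *: (- L * expR (- L * t)) + expR (- L * t) *: dV t.
move: ab; rewrite le_eqVlt => /predU1P[<-|ab].
  by rewrite subrr mulr0 expR0 mul1r.
have [||c] := @MVT R g dg a b ab.
- move=> t; rewrite in_itv/= => tab.
  have dV' := Vd _ tab; have dE := is_derive_expR_lin (- L) t.
  exact: is_deriveM.
- have Ec : {within `[a, b], continuous (fun s : R => expR (- L * s))}.
    exact/continuous_subspaceT/continuous_expR_lin.
  by move=> t; apply: cvgM; [exact: Vc|exact: Ec].
rewrite in_itv/= => cab gE.
have : g b <= g a.
  rewrite -subr_le0 gE mulr_le0_ge0 ?subr_ge0 ?(ltW ab)//.
  have -> : dg c = expR (- L * c) * (dV c - L * V c).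
    by rewrite /dg /GRing.scale/=; ring.
  by rewrite mulr_ge0_le0 ?expR_ge0// subr_le0 dVle.
rewrite [X in X <= _]/(_ * _) [X in _ <= X]/(_ * _)/= => gba.
have -> : L * (b - a) = - L * a - - L * b by ring.
rewrite expRB mulrAC ler_pdivlMr ?expR_gt0//.
by rewrite [_ * V a]mulrC.
Qed.

(** * Integrals over the half-line of exponentially dominated functions *)

Section ImproperIntegral.
Context {R : realType}.
Notation mu := (@lebesgue_measure R).

Lemma cvg_expR_lin (k : R) : 0 < k -> expR (- k * t) @[t --> +oo] --> (0 : R).
Proof.
move=> k0.
rewrite (_ : (fun _ => _) = (fun t : R => expR (- t)) \o (fun t => k * t)).
  apply: cvg_comp; last exact: cvgr_expR.
  exact: gt0_cvgMry.
by apply/funext => t /=; rewrite mulNr.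
Qed.

Lemma continuous_at_right (F : R -> R) (a : R) :
  {for a, continuous F} -> F x @[x --> a^'+] --> F a.
Proof. exact: cvg_at_right_filter. Qed.

Lemma integrable_expR_lin (k : R) : 0 < k ->
  mu.-integrable `[0, +oo[ (fun t => (expR (- k * t))%:E).
Proof.
move=> k0; apply/integrableP; split.
  apply/measurable_EFinP; apply: measurable_funTS.
  by apply: continuous_measurable_fun; exact: continuous_expR_lin.
under eq_integral => t _ do rewrite gee0_abs ?lee_fin ?expR_ge0//.
have dF (t : R) : is_derive t 1 (fun s : R => - k^-1 * expR (- k * s))
    (expR (- k * t)).
  rewrite [X in is_derive _ _ X](_ : _ = - k^-1 *: (fun s => expR (- k * s)));
    last by apply/funext.
  have dE := is_derive_expR_lin (- k) t.
  apply: is_derive_eq; rewrite /GRing.scale/= mulrA mulrNN mulVf ?gt_eqF//.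
  by rewrite mul1r.
rewrite (@ge0_continuous_FTC2y R _ (fun s => - k^-1 * expR (- k * s)) 0 0).
- by rewrite -EFinB ltry.
- by move=> x _; exact: expR_ge0.
- exact/continuous_subspaceT/continuous_expR_lin.
- rewrite -(mulr0 (- k^-1)); apply: cvgM; first exact: cvg_cst.
  exact: cvg_expR_lin.
- by move=> x _; have [] := dF x.
- apply: continuous_at_right.
  by apply/differentiable_continuous/derivable1_diffP; have [] := dF 0.
- by move=> x _; rewrite derive1E; have [_ ->] := dF x.
Qed.

Lemma integrable_expR_dominated (f : R -> R) (M k : R) : 0 < k ->
  continuous f -> (forall t, 0 <= t -> `|f t| <= M * expR (- k * t)) ->
  mu.-integrable `[0, +oo[ (fun t => (f t)%:E).
Proof.
move=> k0 fc fM.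
apply: (@le_integrable _ _ _ mu _ _ _
  (fun t => M%:E * (expR (- k * t))%:E)%E) => //.
- apply/measurable_EFinP; apply: measurable_funTS.
  exact: continuous_measurable_fun.
- move=> t; rewrite /= in_itv/= andbT => t0.
  by rewrite lee_fin (le_trans (fM _ t0))// ler_norm.
- by apply: integrableZl => //; exact: integrable_expR_lin.
Qed.

(** Reduction to nonnegative integrands: with [e t = M e^{-k t}] dominating [|f|], both [f + e] and
    [e] are nonnegative on the half-line, and subtracting their two formulas leaves the one for
    [f]. *)
Lemma Rintegral_FTC2y_dominated (f F : R -> R) (M k : R) : 0 < k ->
  continuous f -> (forall t, 0 <= t -> `|f t| <= M * expR (- k * t)) ->
  (forall t : R, is_derive t 1 F (f t)) -> F t @[t --> +oo] --> (0 : R) ->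
  \int[mu]_(t in `[0, +oo[) f t = - F 0.
Proof.
move=> k0 fc fM dF F0.
have fi := integrable_expR_dominated k0 fc fM.
pose e (t : R) := M * expR (- k * t).
pose E (t : R) := - (M / k) * expR (- k * t).
have ec : continuous e.
  by move=> t; apply: cvgM; [exact: cvg_cst|exact: continuous_expR_lin].
have e0 t : 0 <= t -> 0 <= e t by move=> /fM; apply: le_trans.
have ei : mu.-integrable `[0, +oo[ (fun t => (e t)%:E).
  apply: (@integrable_expR_dominated _ M k) => // t t0.
  by rewrite ger0_norm ?e0.
have dE (t : R) : is_derive t 1 E (e t).
  rewrite (_ : E = - (M / k) *: (fun s => expR (- k * s)));
    last by apply/funext.
  have dexp := is_derive_expR_lin (- k) t.
  apply: is_derive_eq; rewrite /GRing.scale/= /e; field.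
  by rewrite gt_eqF.
have E0 : E t @[t --> +oo] --> (0 : R).
  rewrite -(mulr0 (- (M / k))); apply: cvgM; first exact: cvg_cst.
  exact: cvg_expR_lin.
have ftc (g G : R -> R) : (forall t, 0 <= t -> 0 <= g t) -> continuous g ->
    (forall t : R, is_derive t 1 G (g t)) -> G t @[t --> +oo] --> (0 : R) ->
    \int[mu]_(t in `[0, +oo[) g t = - G 0.
  move=> g0 gc dG Gy; rewrite (@Rintegral_ge0_continuous_FTC2y R g G 0 0)//.
  - by rewrite sub0r.
  - exact: continuous_subspaceT gc.
  - apply: continuous_at_right.
    by apply/differentiable_continuous/derivable1_diffP; have [] := dG 0.
  - by move=> x _; rewrite derive1E; have [_ ->] := dG x.
have : \int[mu]_(t in `[0, +oo[) (f t + e t) = - (F 0 + E 0).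
  apply: (ftc (f \+ e) (F + E)).
  - move=> t t0 /=; rewrite -lerBlDr sub0r.
    by have := fM _ t0; rewrite ler_norml => /andP[].
  - by move=> t; apply: cvgD; [exact: fc|exact: ec].
  - by rewrite -(addr0 0); exact: cvgD.
rewrite RintegralD// (ftc _ _ e0 ec dE E0) opprD => /addIr.
exact.
Qed.

End ImproperIntegral.

(** * Linearity of integrals of matrix-valued functions *)

Lemma Rintegral_sum (d : measure_display) (T : measurableType d) (R : realType)
    (mu : {measure set T -> \bar R}) (D : set T) (I : Type) (s : seq I)
    (f : I -> T -> R) :
  measurable D ->
  (forall i, mu.-integrable D (EFin \o f i)) ->
  mu.-integrable D (EFin \o (fun x => \sum_(i <- s) f i x)) /\
  \int[mu]_(x in D) (\sum_(i <- s) f i x) =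
  \sum_(i <- s) \int[mu]_(x in D) f i x.
Proof.
(* Integrability and value go through one induction, because additivity of the integral asks for
   integrability of the remaining sum. *)
move=> mD fi; elim: s => [|i s [IHi IH]].
  rewrite big_nil.
  under eq_Rintegral do rewrite big_nil.
  rewrite (_ : _ \o _ = cst 0%E); last by apply/funext => x /=; rewrite big_nil.
  by split; [exact: integrable0|rewrite Rintegral_cst// mul0r].
rewrite big_cons; under eq_Rintegral do rewrite big_cons.
rewrite RintegralD// IH; split=> //.
rewrite (_ : _ \o _ = (EFin \o f i) \+
    (EFin \o (fun x => (\sum_(i <- s) f i x)%R)))%E.
  exact: integrableD.
by apply/funext => x /=; rewrite big_cons EFinD.
Qed.

Section MatrixIntegral.
Context {R : realType}.
Variables (D : set (measurableTypeR R)) (mD : measurable D).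

Lemma mx_integrableMl (m n p : nat) (M : 'M[R]_(m, n)) (F : R -> 'M[R]_(n, p)) :
  mx_integrable D F ->
  mx_integrable D (fun t => M *m F t) /\
  mx_integral D (fun t => M *m F t) = M *m mx_integral D F.
Proof.
move=> Fi.
have MFi i j k : lebesgue_measure.-integrable D
    (EFin \o (fun t => M i k * F t k j)).
  rewrite (_ : _ \o _ = (fun t => (M i k)%:E * (F t k j)%:E)%E)//.
  exact: integrableZl.
split=> [i j|].
  have [+ _] := Rintegral_sum (index_enum _) mD (MFi i j).
  by apply: eq_integrable => // t _ /=; rewrite mxE.
apply/matrixP => i j; rewrite !mxE.
under eq_Rintegral => t _ do rewrite mxE.
have [_ ->] := Rintegral_sum (index_enum _) mD (MFi i j).
apply: eq_bigr => k _; rewrite RintegralZl//; first by rewrite mxE.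
exact: Fi.
Qed.

Lemma mx_integrable_tr (m n : nat) (F : R -> 'M[R]_(m, n)) :
  mx_integrable D F -> mx_integrable D (fun t => (F t)^T).
Proof.
by move=> Fi i j; apply: eq_integrable (Fi j i) => // t _ /=; rewrite mxE.
Qed.

Lemma mx_integral_tr (m n : nat) (F : R -> 'M[R]_(m, n)) :
  mx_integral D (fun t => (F t)^T) = (mx_integral D F)^T.
Proof.
by apply/matrixP => i j; rewrite !mxE; under eq_Rintegral => t _ do rewrite mxE.
Qed.

Lemma mx_integrableMr (m n p : nat) (F : R -> 'M[R]_(m, n)) (M : 'M[R]_(n, p)) :
  mx_integrable D F ->
  mx_integrable D (fun t => F t *m M) /\
  mx_integral D (fun t => F t *m M) = mx_integral D F *m M.
Proof.
move=> Fi; have [MFi MFE] := mx_integrableMl M^T (mx_integrable_tr Fi).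
have FME t : F t *m M = (M^T *m (F t)^T)^T by rewrite trmx_mul !trmxK.
rewrite (_ : (fun _ => _) = (fun t => (M^T *m (F t)^T)^T)); last exact/funext.
split; first exact: mx_integrable_tr.
by rewrite mx_integral_tr MFE mx_integral_tr trmx_mul !trmxK.
Qed.

Lemma mx_integralD (m n : nat) (F G : R -> 'M[R]_(m, n)) :
  mx_integrable D F -> mx_integrable D G ->
  mx_integral D (fun t => F t + G t) = mx_integral D F + mx_integral D G.
Proof.
move=> Fi Gi; apply/matrixP => i j; rewrite !mxE.
under eq_Rintegral => t _ do rewrite mxE.
by rewrite RintegralD//; [exact: Fi|exact: Gi].
Qed.

End MatrixIntegral.

(** * The Gramian: convergence, Lyapunov equation, symmetry and positivity *)

Section Gramian.
Context {R : realType} {n p : nat}.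
Variables (A : 'M[R]_n) (B : 'M[R]_(n, p)) (lambda : R).

Let F := gramian_integrand A B lambda.
Let As := A + lambda%:M.

Lemma gramian_integrandE t :
  F t = expR (- 2 * lambda * t) *:
    (expmx (t *: - A) *m (B *m B^T *m (expmx (t *: - A))^T)).
Proof.
rewrite /F /gramian_integrand !scaleNr -!scalerN -expmxZ_trmx.
by rewrite [(- A)^T]linearN !mulmxA.
Qed.

Lemma gramian_integrand0 : F 0 = B *m B^T.
Proof.
rewrite gramian_integrandE mulr0 expR0 scale1r scale0r expmx0 mul1mx.
by rewrite trmx1 mulmx1.
Qed.

Lemma gramian_integrand_tr t : (F t)^T = F t.
Proof.
by rewrite gramian_integrandE linearZ/= !trmx_mul !trmxK !mulmxA.
Qed.

(** The product rule gives [- 2 lambda F - A F - F A^T]; splitting the scalar evenly between the two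
    sides turns [A] into [As]. *)
Lemma gramian_integrand_derive t :
  has_mxderive F t (- As *m F t + F t *m (- As)^T).
Proof.
have dE : has_mxderive (fun s => expmx (s *: - A)) t (- A *m expmx (t *: - A)).
  by move=> i j; exact: is_derive_expmxZ.
have ds := is_derive_expR_lin (- 2 * lambda) t.
have := has_mxderiveZ ds (has_mxderiveM dE
  (has_mxderiveMl (B *m B^T) (has_mxderive_tr dE))).
move=> dF i j; have := dF i j.
rewrite (_ : (fun s => _) = F ^~ i ^~ j); last first.
  by apply/funext => s; rewrite gramian_integrandE.
rewrite (_ : ((- 2 * lambda * _) *: _ + _) = - As *m F t + F t *m (- As)^T)//.
rewrite gramian_integrandE; set E := expmx _; set s := expR _.
set C := B *m B^T; have NAs : (- As)^T = - A^T - lambda%:M.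
  by rewrite /As linearN/= linearD/= tr_scalar_mx opprD.
have -> : (- A *m E)^T = - (E^T *m A^T) by rewrite mulNmx linearN/= trmx_mul.
rewrite NAs /As [- (A + _)]opprD mulmxDl mulmxDr !mulNmx !mulmxN.
rewrite mul_scalar_mx mul_mx_scalar !mulmxA -scalemxAr -!scalemxAl !mulmxA.
(* Once the matrix products are generalized, only a linear identity remains, checked entrywise. *)
move: (A *m E *m _ *m _ *m _) (E *m _ *m _ *m _) (_ *m A^T) => X Y Z.
by apply/matrixP => k l; rewrite !mxE; ring.
Qed.

(** Each of the two exponentials contributes a factor [n * n], from its entry bound summed over all
    entries; [B] and [B^T] contribute [mxl1 B] each. *)
Definition gramian_integrand_bound : R :=
  (n * n)%:R * (mxl1 B * mxl1 B * (n * n)%:R).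

(** Each exponential grows at most like [e^{t mxl1 A}], and the two together are outweighed by
    [e^{-2 lambda t}] as soon as [lambda] exceeds [mxl1 A]. *)
Lemma gramian_integrand_le t : 0 <= t ->
  mxl1 (F t) <= gramian_integrand_bound * expR (- (2 * (lambda - mxl1 A)) * t).
Proof.
move=> t0; set E := expmx (t *: - A); set e := expR (mxl1 A * t).
have El : mxl1 E <= (n * n)%:R * e.
  apply: mxl1_le_const => i j; apply: le_trans (expmxZ_entry_le _ _ _ _) _.
  by rewrite mxl1N ger0_norm.
rewrite gramian_integrandE -/E mxl1Z ger0_norm ?expR_ge0//.
have -> : - (2 * (lambda - mxl1 A)) * t =
  - 2 * lambda * t + (mxl1 A * t + mxl1 A * t) by ring.
rewrite !expRD -/e mulrCA ler_wpM2l ?expR_ge0//.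
apply: (@le_trans _ _
    (((n * n)%:R * e) * (mxl1 B * mxl1 B * ((n * n)%:R * e)))).
  apply: le_trans (mxl1M _ _) _; apply: ler_pM => //; try exact: mxl1_ge0.
  apply: le_trans (mxl1M _ _) _; apply: ler_pM => //; try exact: mxl1_ge0.
    by rewrite -[X in _ <= _ * X]mxl1_trmx mxl1M.
  by rewrite mxl1_trmx.
rewrite le_eqVlt; apply/orP; left; apply/eqP.
rewrite /gramian_integrand_bound; ring.
Qed.

Hypothesis lambda_large : mxl1 A < lambda.

Let k_gt0 : 0 < 2 * (lambda - mxl1 A).
Proof. by rewrite mulr_gt0// subr_gt0. Qed.

Lemma gramian_integrand_continuous i j : continuous (fun t => F t i j).
Proof.
by move=> t; exact: has_mxderive_continuous (gramian_integrand_derive t).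
Qed.

Lemma gramian_integrand_integrable : mx_integrable `[0, +oo[ F.
Proof.
move=> i j; apply: integrable_expR_dominated k_gt0 _ _.
  exact: gramian_integrand_continuous.
move=> t t0; apply: le_trans (gramian_integrand_le t0).
exact: entry_le_mxl1.
Qed.

Lemma gramian_integrand_cvg0 i j : F t i j @[t --> +oo] --> (0 : R).
Proof.
set M := gramian_integrand_bound.
have cvgM0 : M * expR (- (2 * (lambda - mxl1 A)) * t) @[t --> +oo] --> (0 : R).
  by rewrite -(mulr0 M); apply: cvgM; [exact: cvg_cst|exact: cvg_expR_lin].
apply: norm_cvg0.
apply: (@squeeze_cvgr _ _ _ _ (cst 0) _ _ _ _ _ cvgM0); last exact: cvg_cst.
near=> t; rewrite /= normr_ge0/=.
have t0 : 0 <= t by near: t; exact: nbhs_pinfty_ge.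
by apply: le_trans (gramian_integrand_le t0); exact: entry_le_mxl1.
Unshelve. all: by end_near. Qed.

Lemma gramian_lyapunov :
  As *m gramian A B lambda + gramian A B lambda *m As^T = B *m B^T.
Proof.
have mD : measurable (`[0, +oo[ : set (measurableTypeR R)) by [].
have Fi := gramian_integrand_integrable.
have [li lE] := mx_integrableMl mD (- As) Fi.
have [ri rE] := mx_integrableMr mD (- As)^T Fi.
pose D t := - As *m F t + F t *m (- As)^T.
have DE : mx_integral `[0, +oo[ D = - F 0.
  apply/matrixP => i j; rewrite [LHS]mxE [RHS]mxE.
  (* The dominating constant comes from the triangle inequality and submultiplicativity applied to
     the two terms of [D]. [F] vanishes at infinity, so only [- F 0] survives. *)
  apply: (@Rintegral_FTC2y_dominated _ (fun t => D t i j) (fun t => F t i j)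
    (mxl1 (- As) * gramian_integrand_bound +
     gramian_integrand_bound * mxl1 (- As))
    _ k_gt0).
  - move=> t; apply: has_mxderive_continuous.
    apply: has_mxderiveD.
      apply: has_mxderiveMl; exact: gramian_integrand_derive.
    apply: has_mxderiveMr; exact: gramian_integrand_derive.
  - move=> t t0; apply: le_trans (entry_le_mxl1 _ _ _) _.
    apply: le_trans (mxl1D _ _) _; rewrite mulrDl; apply: lerD.
      apply: le_trans (mxl1M _ _) _; rewrite -mulrA ler_wpM2l ?mxl1_ge0//.
      exact: gramian_integrand_le.
    apply: le_trans (mxl1M _ _) _.
    rewrite mulrAC mxl1_trmx ler_wpM2r ?mxl1_ge0//.
    exact: gramian_integrand_le.
  - by move=> t; exact: gramian_integrand_derive.
  - exact: gramian_integrand_cvg0.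
have := mx_integralD mD li ri; rewrite -/D DE lE rE gramian_integrand0.
rewrite -/(gramian A B lambda) mulNmx linearN/= mulmxN -opprD.
by move=> /oppr_inj ->.
Qed.

Lemma gramian_tr : (gramian A B lambda)^T = gramian A B lambda.
Proof.
rewrite /gramian -mx_integral_tr; congr mx_integral.
by apply/funext => t; exact: gramian_integrand_tr.
Qed.

(** Under the integral, the form is [e^{-2 lambda t}] times the squared norm of
    [B^T e^{-tA^T} v]. *)
Lemma gramian_ge0 (v : 'cV[R]_n) : 0 <= (v^T *m gramian A B lambda *m v) 0 0.
Proof.
have mD : measurable (`[0, +oo[ : set (measurableTypeR R)) by [].
have Fi := gramian_integrand_integrable.
have [li lE] := mx_integrableMl mD v^T Fi.
have [ri rE] := mx_integrableMr mD v li.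
rewrite /gramian -/F -lE -rE mxE; apply: Rintegral_ge0 => t _.
rewrite gramian_integrandE -scalemxAr -scalemxAl mxE mulr_ge0 ?expR_ge0//.
set w := B^T *m (expmx (t *: - A))^T *m v.
rewrite (_ : _ *m v = w^T *m w); last first.
  by rewrite /w !trmx_mul !trmxK !mulmxA.
by rewrite mxE; apply: sumr_ge0 => i _; rewrite mxE -expr2 sqr_ge0.
Qed.

End Gramian.

(** * The Euclidean norm and quadratic forms *)

Section QuadraticForm.
Context {R : realType} {n : nat}.

Definition sqnorm (v : 'cV[R]_n) : R := (v^T *m v) 0 0.

Lemma sqnormE v : sqnorm v = \sum_i v i 0 ^+ 2.
Proof. by rewrite /sqnorm mxE; apply: eq_bigr => i _; rewrite mxE expr2. Qed.

Lemma sqnorm_ge0 v : 0 <= sqnorm v.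
Proof. by rewrite sqnormE; apply: sumr_ge0 => i _; exact: sqr_ge0. Qed.

Lemma sqnorm_eq0 v : sqnorm v = 0 -> v = 0.
Proof.
move=> /eqP; rewrite sqnormE psumr_eq0 => [/allP v0|i _]; last exact: sqr_ge0.
apply/matrixP => i j; rewrite ord1 [RHS]mxE; apply/eqP.
by rewrite -sqrf_eq0; apply: v0; rewrite mem_index_enum.
Qed.

Lemma enormE v : enorm v = Num.sqrt (sqnorm v).
Proof. by rewrite sqnormE. Qed.

(** Every product [|v_i| |v_j|] is at most the squared norm of [v], so only the sum of the absolute
    entries of [X] remains. *)
Lemma normr_quadratic_form_le (X : 'M[R]_n) (v : 'cV[R]_n) :
  `|(v^T *m X *m v) 0 0| <= mxl1 X * sqnorm v.
Proof.
have vij i j : `|v i 0| * `|v j 0| <= sqnorm v.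
  have sq k : `|v k 0| ^+ 2 <= sqnorm v.
    rewrite real_normK ?num_real// sqnormE (bigD1 k)//= lerDl.
    by apply: sumr_ge0 => l _; exact: sqr_ge0.
  have := sq i; have := sq j; nra.
rewrite mxE; apply: le_trans (ler_norm_sum _ _ _) _.
rewrite /mxl1 exchange_big/= mulr_suml; apply: ler_sum => j _.
rewrite mxE normrM mulr_suml.
apply: le_trans (ler_wpM2r _ (ler_norm_sum _ _ _)) _ => //.
rewrite mulr_suml; apply: ler_sum => i _.
by rewrite mxE normrM mulrAC mulrC ler_wpM2l.
Qed.

End QuadraticForm.

(** * Continuity within a set and integrability on segments *)

Section WithinContinuous.
Context {R : realType} {D : set R}.

Lemma within_continuous_entry (m n : nat) (M : R -> 'M[R]_(m, n)) i j :
  {within D, continuous M} -> {within D, continuous (fun s => M s i j)}.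
Proof.
move=> Mc t; have Xc := @coord_continuous R m n i j (M t).
exact: cvg_comp (Mc t) Xc.
Qed.

Lemma within_continuousM (m n p : nat) (M : R -> 'M[R]_(m, n))
    (N : R -> 'M[R]_(n, p)) :
  (forall i j, {within D, continuous (fun s => M s i j)}) ->
  (forall i j, {within D, continuous (fun s => N s i j)}) ->
  forall i j, {within D, continuous (fun s => (M s *m N s) i j)}.
Proof.
move=> Mc Nc i j.
rewrite (_ : (fun _ => _) = (fun s => \sum_k M s i k * N s k j)); last first.
  by apply/funext => s; rewrite mxE.
move=> t; apply: cvg_big => [|k _]; first exact: add_continuous.
by apply: cvgM; [exact: Mc|exact: Nc].
Qed.

Lemma within_continuous_cst (m n : nat) (M : 'M[R]_(m, n)) i j :
  {within D, continuous (fun=> M i j)}.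
Proof. by move=> t; exact: cvg_cst. Qed.

End WithinContinuous.

(** The endpoints form a null set. Controls are given on the open interval, while the integrated
    equation uses closed ones. *)
Lemma integrable_itvoo_itvcc (R : realType) (a b : R) (f : R -> R) :
  lebesgue_measure.-integrable `]a, b[ (EFin \o f) ->
  lebesgue_measure.-integrable `[a, b] (EFin \o f).
Proof.
move=> /integrableP[mf fi]; apply/integrableP; split.
  apply/emeasurable_fun_itv_obnd_cbndP.
  exact/emeasurable_fun_itv_bndo_bndcP.
rewrite (@integral_itv_bndoo _ a b)//.
exact: measurableT_comp.
Qed.

(** On a bounded interval the function [1 + u^2] is integrable, and it dominates [|u|] because
    [(|u| - 1)^2 >= 0]. *)
Lemma L2_control_integrable (R : realType) (p : nat) (a b : R)
    (u : R -> 'cV[R]_p) :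
  L2_control a b u -> mx_integrable `[a, b] u.
Proof.
move=> uL2 j k; rewrite (ord1 k); have [mu ui] := uL2 j.
apply: integrable_itvoo_itvcc.
have ci : lebesgue_measure.-integrable `]a, b[ (EFin \o (fun=> 1 : R)).
  have ci : lebesgue_measure.-integrable `[a, b] (EFin \o (fun=> 1 : R)).
    apply: continuous_compact_integrable; first exact: segment_compact.
    by move=> t; exact: cvg_cst.
  by apply: integrableS ci => //; exact: subset_itv_oo_cc.
have gi : lebesgue_measure.-integrable `]a, b[
    (EFin \o (fun t => 1 + u t j 0 ^+ 2)).
  by rewrite (_ : _ \o _ = (EFin \o (fun=> 1%R : R)) \+
    (fun t => (u t j 0 ^+ 2)%:E))%E//; exact: integrableD.
apply: le_integrable gi => //.
- exact/measurable_EFinP.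
- move=> t _ /=; rewrite lee_fin.
  have := sqr_ge0 (u t j 0); have := sqr_ge0 (`|u t j 0| - 1).
  have := real_normK (num_real (u t j 0)).
  by move=> sqE ? ?; apply: le_trans (ler_norm _); nra.
Qed.

Lemma continuous_mx_integrable (R : realType) (m n : nat) (a b : R)
    (M : R -> 'M[R]_(m, n)) :
  (forall i j, {within `[a, b], continuous (fun s => M s i j)}) ->
  mx_integrable `[a, b] M.
Proof.
move=> Mc i j; apply: continuous_compact_integrable; last exact: Mc.
exact: segment_compact.
Qed.

Lemma mx_integrableD (R : realType) (m n : nat) (D : set (measurableTypeR R))
    (F G : R -> 'M[R]_(m, n)) :
  measurable D -> mx_integrable D F -> mx_integrable D G ->
  mx_integrable D (fun t => F t + G t).
Proof.
move=> mD Fi Gi i j.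
apply: eq_integrable (integrableD mD (Fi i j) (Gi i j)) => // t _ /=.
by rewrite mxE EFinD.
Qed.

(** * From controllability to invertibility of the Gramian *)

Lemma tr_entry00 (R : Type) (M : 'M[R]_1) : M^T 0 0 = M 0 0.
Proof. by rewrite mxE. Qed.

(** The diagonal entries of [X *m X^T] are the sums of squares of the rows of [X]. *)
Lemma mulmx_tr_eq0 (R : realDomainType) (m n : nat) (X : 'M[R]_(m, n)) :
  X *m X^T = 0 -> X = 0.
Proof.
move=> XX; apply/matrixP => i j; rewrite mxE; apply/eqP; rewrite -sqrf_eq0.
have /matrixP/(_ i i)/eqP := XX; rewrite !mxE.
under eq_bigr do rewrite mxE -expr2.
rewrite psumr_eq0 => [/allP Xi|k _]; last exact: sqr_ge0.
by apply: Xi; rewrite mem_index_enum.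
Qed.

Section Controllability.
Context {R : realType} {n p : nat}.
Variables (A : 'M[R]_n) (B : 'M[R]_(n, p)) (t0 t1 : R).
Hypothesis lt_t0t1 : t0 < t1.

(** Gronwall applied to the squared norm of [z], whose derivative [2 z^T N z] is at most
    [2 * mxl1 N] times that squared norm. *)
Lemma linear_ode_eq0 (m : nat) (N : 'M[R]_m) (z : R -> 'cV[R]_m) :
  (forall i j, {within `[t0, t1], continuous (fun s => z s i j)}) ->
  (forall t, t0 < t < t1 -> has_mxderive z t (N *m z t)) ->
  z t0 = 0 -> z t1 = 0.
Proof.
move=> zc dz z0.
pose dV t := ((N *m z t)^T *m z t + (z t)^T *m (N *m z t)) 0 0.
have Vc : {within `[t0, t1], continuous (fun s => sqnorm (z s))}.
  apply: within_continuousM => // i j.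
  rewrite (_ : (fun _ => _) = (fun s => z s j i)); first exact: zc.
  by apply/funext => s; rewrite mxE.
have := gronwall_derive (L := 2 * mxl1 N) (dV := dV) (ltW lt_t0t1) Vc.
have -> : sqnorm (z t0) = 0 by rewrite z0 /sqnorm mulmx0 mxE.
rewrite mulr0 => H; apply: sqnorm_eq0; apply/eqP.
rewrite eq_le sqnorm_ge0 andbT; apply: H => t tab.
  exact: (has_mxderiveM (has_mxderive_tr (dz t tab)) (dz t tab)).
have -> : dV t = 2 * ((z t)^T *m N *m z t) 0 0.
  rewrite /dV mxE mulmxA mulr_natl mulr2n; congr (_ + _).
  by rewrite -[LHS]tr_entry00 trmx_mul trmxK mulmxA.
rewrite -mulrA ler_pM2l//.
exact: le_trans (ler_norm _) (normr_quadratic_form_le _ _).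
Qed.

(* [z = K x] satisfies the autonomous equation [z' = N z], which the control
   does not enter: from [x t0 = 0] only states of [ker K] can be reached. *)
Lemma controllable_invariant_kernel (m : nat) (K : 'M[R]_(m, n)) (N : 'M[R]_m) :
  controllable A B t0 t1 -> K *m A = N *m K -> K *m B = 0 -> K = 0.
Proof.
move=> ctrl KA KB.
suff Kv (v : 'cV[R]_n) : K *m v = 0.
  apply/matrixP => i j; have /matrixP/(_ i 0) := Kv (delta_mx j 0).
  by rewrite -colE !mxE.
have [u uL2 [x [[xc xE] x0 x1]]] := ctrl 0 v.
pose z s := K *m x s; rewrite -x1 -/(z t1).
have zc i j : {within `[t0, t1], continuous (fun s => z s i j)}.
  apply: within_continuousM => k l; first exact: within_continuous_cst.
  exact: within_continuous_entry.
have Nzc i j : {within `[t0, t1], continuous (fun s => (N *m z s) i j)}.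
  by apply: within_continuousM => k l; [exact: within_continuous_cst|exact: zc].
have mD a b : measurable (`[a, b] : set (measurableTypeR R)) by [].
have gi : mx_integrable `[t0, t1] (fun s => A *m x s + B *m u s).
  apply: mx_integrableD => //.
    apply: (mx_integrableMl (mD _ _) A _).1.
    by apply: continuous_mx_integrable => i j; exact: within_continuous_entry.
  exact: (mx_integrableMl (mD _ _) B (L2_control_integrable uL2)).1.
have zE t : t0 <= t <= t1 -> z t = mx_integral `[t0, t] (fun s => N *m z s).
  move=> tt; rewrite /z xE// x0 add0r.
  have git : mx_integrable `[t0, t] (fun s => A *m x s + B *m u s).
    move=> i j; apply: integrableS (gi i j) => //.
    by apply: subset_itvl; rewrite bnd_simp; case/andP: tt.
  have [_ <-] := mx_integrableMl (mD _ _) K git.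
  congr mx_integral; apply/funext => s.
  by rewrite mulmxDr !mulmxA KA KB mul0mx addr0.
apply: (linear_ode_eq0 (N := N) zc) => [t tt|];
  last by rewrite /z x0 mulmx0.
move=> i j; have [tl tr] := andP tt.
have ctsN : {for t, continuous (fun s => (N *m z s) i j)}.
  have /continuous_within_itvP := Nzc i j; move=> /(_ lt_t0t1)[+ _ _]; apply.
  by rewrite in_itv/=.
(* A Caratheodory solution satisfies only an integral equation, but the integrand [N z] is
   continuous, so the fundamental theorem of calculus makes [z] differentiable at interior points.
   The integral formula for [z] holds on the segment only, hence the comparison near [t]. *)
have [dN NE] :=
  continuous_FTC1_closed tr (continuous_mx_integrable Nzc i j) tl ctsN.
apply: (@near_eq_is_derive _ _ _
  (fun y => \int[lebesgue_measure]_(s in `[t0, y]) (N *m z s) i j)).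
  have /near_in_itvoo : t \in `]t0, t1[ by rewrite in_itv.
  apply: filterS => y; rewrite in_itv/= => /andP[yl yr].
  by rewrite zE ?mxE// !ltW.
by apply: DeriveDef => //; rewrite -derive1E.
Qed.

(* The Lyapunov equation makes the kernel of [Q] invariant under [As] and
   contained in the kernel of [B^T]. *)
Lemma lyapunov_unitmx (Q As : 'M[R]_n) (c : R) :
  controllable A B t0 t1 -> As = A + c%:M -> Q^T = Q ->
  As *m Q + Q *m As^T = B *m B^T -> Q \in unitmx.
Proof.
move=> ctrl AsE Qtr lyap; pose K := kermx Q.
have KQ : K *m Q = 0 by exact: mulmx_ker.
have QK : Q *m K^T = 0 by apply: trmx_inj; rewrite trmx0 trmx_mul trmxK Qtr.
have KB : K *m B = 0.
  (* Multiplying the Lyapunov equation by [K] on the left and [K^T] on the right annihilates both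
     terms of its left side. *)
  have KBB : (K *m B) *m (K *m B)^T = 0.
    rewrite trmx_mul mulmxA -(mulmxA K) -lyap mulmxDr mulmxDl !mulmxA KQ.
    by rewrite !mul0mx addr0 -!mulmxA QK !mulmx0.
  exact: mulmx_tr_eq0.
(* With [K *m B = 0] known, multiplying by [K] on the left alone shows that the rows of [K *m As]
   lie in the left kernel of [Q], which the rows of [K] span. *)
have KAsQ : K *m As *m Q = 0.
  have : K *m (As *m Q + Q *m As^T) = 0 by rewrite lyap mulmxA KB mul0mx.
  by rewrite mulmxDr !mulmxA KQ mul0mx addr0.
have /submxP[N KAs] : (K *m As <= K)%MS by apply/sub_kermxP.
have K0 : K = 0.
  (* Removing the shift: [K As = N K] with [As = A + c] reads [K A = (N - c) K]. *)
  apply: (@controllable_invariant_kernel _ K (N - c%:M)) => //.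
  rewrite mulmxBl -KAs AsE mulmxDr mul_scalar_mx mul_mx_scalar.
  by rewrite addrK.
rewrite -row_free_unit -kermx_eq0; exact/eqP.
Qed.

End Controllability.

(** * Cauchy-Schwarz for semidefinite forms and the trace bound *)

Section PositiveForms.
Context {R : realType} {n : nat}.

Lemma psd_cauchy_schwarz (P : 'M[R]_n) (v w : 'cV[R]_n) :
  P^T = P -> (forall y : 'cV[R]_n, 0 <= (y^T *m P *m y) 0 0) ->
  (v^T *m P *m w) 0 0 ^+ 2 <= (v^T *m P *m v) 0 0 * (w^T *m P *m w) 0 0.
Proof.
move=> Ptr Pge0; set b := (v^T *m P *m w) 0 0; set a := (v^T *m P *m v) 0 0.
set c := (w^T *m P *m w) 0 0.
have wv : (w^T *m P *m v) 0 0 = b.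
  by rewrite /b -[LHS]tr_entry00 !trmx_mul trmxK Ptr mulmxA.
have ED (M N : 'M[R]_1) : (M + N) 0 0 = M 0 0 + N 0 0 by rewrite mxE.
have EZ k (M : 'M[R]_1) : (k *: M) 0 0 = k * M 0 0 by rewrite mxE.
have form s r : 0 <= s ^+ 2 * a + 2 * (s * r) * b + r ^+ 2 * c.
  have := Pge0 (s *: v + r *: w).
  rewrite [_^T]linearD !linearZ/=.
  rewrite !mulmxDl !mulmxDr -!scalemxAl -!scalemxAr.
  rewrite !(ED, EZ) -/a -/b -/c wv.
  by move=> h; lra.
have a0 : 0 <= a by exact: Pge0.
have c0 : 0 <= c by exact: Pge0.
have [ce|ce] := eqVneq c 0.
  have [->|b0] := eqVneq b 0; first by rewrite expr0n mulr_ge0.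
  (* With [c = 0] the form is affine in the second coefficient; this value makes it equal to [-1],
     which is absurd. *)
  have := form 1 (- (a + 1) / (2 * b)); rewrite ce.
  rewrite (_ : 1 ^+ 2 * a + _ + _ = -1); first by rewrite oppr_ge0 ler10.
  by field.
have cgt0 : 0 < c by rewrite lt0r ce.
(* At [s = c], [r = - b] the form equals [c * (a * c - b ^+ 2)]. *)
by rewrite -(ler_pM2l cgt0); have := form c (- b); lra.
Qed.

(** Write [v_i = v^T Q^-1 (Q e_i)]. Cauchy-Schwarz for [Q^-1] bounds [v_i^2] by [v^T Q^-1 v] times
    the diagonal entry [e_i^T Q e_i], and summing over [i] produces the trace. *)
Lemma sqnorm_le_form (Q : 'M[R]_n) (v : 'cV[R]_n) :
  Q \in unitmx -> Q^T = Q -> (forall y : 'cV[R]_n, 0 <= (y^T *m Q *m y) 0 0) ->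
  sqnorm v <= \tr Q * (v^T *m invmx Q *m v) 0 0.
Proof.
move=> Qu Qtr Qge0.
have Ptr : (invmx Q)^T = invmx Q by rewrite trmx_inv Qtr.
have Pge0 (y : 'cV[R]_n) : 0 <= (y^T *m invmx Q *m y) 0 0.
  have := Qge0 (invmx Q *m y).
  by rewrite trmx_mul Ptr -!mulmxA (mulKVmx Qu).
rewrite sqnormE /mxtrace mulr_suml; apply: ler_sum => i _.
have := psd_cauchy_schwarz v (Q *m delta_mx i 0) Ptr Pge0.
rewrite trmx_mul Qtr -!mulmxA (mulKmx Qu) trmx_delta -rowE -!colE.
rewrite mulrC [col i v^T 0 0]mxE [v^T 0 i]mxE.
by rewrite [row _ _ _ _]mxE [col _ _ _ _]mxE.
Qed.

End PositiveForms.

(** * Exponential decay along the closed loop *)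

Section ClosedLoop.
Context {R : realType} {n p : nat}.
Variables (A : 'M[R]_n) (B : 'M[R]_(n, p)) (lambda : R) (Q : 'M[R]_n).
Hypotheses (Q_unit : Q \in unitmx) (Q_tr : Q^T = Q).
Hypothesis Q_ge0 : forall y : 'cV[R]_n, 0 <= (y^T *m Q *m y) 0 0.
Hypothesis Q_lyap :
  (A + lambda%:M) *m Q + Q *m (A + lambda%:M)^T = B *m B^T.

Let P := invmx Q.
Let V (v : 'cV[R]_n) := (v^T *m P *m v) 0 0.

Let P_tr : P^T = P. Proof. by rewrite /P trmx_inv Q_tr. Qed.

(* With [y = P v], the Lyapunov equation gives
   [2 y^T (A + lambda) Q y = |B^T y|^2], hence
   [V' + 2 lambda V = - |B^T y|^2]. *)
Lemma closed_loop_lyapunov_le (v D : 'cV[R]_n) :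
  D = A *m v + B *m (- (B^T *m P) *m v) ->
  (D^T *m P *m v + v^T *m P *m D) 0 0 <= - 2 * lambda * V v.
Proof.
move=> DE; have [y yE] : {y | y = P *m v} by exists (P *m v).
have vE : v = Q *m y by rewrite yE mulKVmx.
have yQ : y^T *m Q = v^T by rewrite -[in LHS]Q_tr -trmx_mul -vE.
have sym : (D^T *m P *m v) 0 0 = (v^T *m P *m D) 0 0.
  by rewrite -[LHS]tr_entry00 !trmx_mul trmxK P_tr mulmxA.
have vP : v^T *m P = y^T by rewrite yE trmx_mul P_tr.
have PDE : (v^T *m P *m D) 0 0 = (y^T *m A *m v) 0 0 - sqnorm (B^T *m y).
  rewrite vP DE mulmxDr mulNmx !mulmxN -!mulmxA -yE /sqnorm trmx_mul trmxK.
  by rewrite !mulmxA [LHS]mxE [X in _ + X]mxE.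
have VE : V v = (y^T *m v) 0 0 by rewrite /V vP.
have lyap : (y^T *m A *m v) 0 0 + lambda * V v +
    ((y^T *m A *m v) 0 0 + lambda * V v) = sqnorm (B^T *m y).
  have L : (y^T *m (A + lambda%:M) *m v) 0 0 =
      (y^T *m A *m v) 0 0 + lambda * V v.
    rewrite mulmxDr mulmxDl mul_mx_scalar -scalemxAl [LHS]mxE VE.
    by rewrite [X in _ + X]mxE.
  have LT : (v^T *m (A + lambda%:M)^T *m y) 0 0 =
      (y^T *m (A + lambda%:M) *m v) 0 0.
    by rewrite -[LHS]tr_entry00 !trmx_mul !trmxK mulmxA.
  rewrite -L -[X in _ + X]LT /sqnorm trmx_mul trmxK mulmxA.
  rewrite -(mulmxA _ B) -Q_lyap.
  rewrite mulmxDr mulmxDl [RHS]mxE; congr (_ + _).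
    by rewrite -!mulmxA -vE.
  by rewrite mulmxA yQ.
have := sqnorm_ge0 (B^T *m y); rewrite mxE sym PDE; lra.
Qed.

(** Gronwall with [L = - 2 * lambda]. It asks for derivatives in the open interval only, which
    matches solutions that are merely continuous at 0. *)
Lemma closed_loop_form_decay (x : R -> 'cV[R]_n) (t : R) :
  closed_loop_solution A B (- (B^T *m P)) x -> 0 <= t ->
  V (x t) <= expR (- 2 * lambda * t) * V (x 0).
Proof.
move=> [xc dx] t0.
have xct : {within `[0, t], continuous x}.
  by apply: continuous_subspaceW xc; exact: subset_itvl.
pose D s := A *m x s + B *m (- (B^T *m P) *m x s).
have := @gronwall_derive R (fun s => V (x s))
  (fun s => ((D s)^T *m P *m x s + (x s)^T *m P *m D s) 0 0)
  (- 2 * lambda) 0 t t0.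
rewrite subr0; apply.
- have ec := within_continuous_entry xct.
  apply: within_continuousM => [i j|]; last exact: ec.
  apply: within_continuousM => [k l|]; last exact: within_continuous_cst.
  rewrite (_ : (fun _ => _) = (fun s => x s l k)); first exact: ec.
  by apply/funext => s; rewrite mxE.
- move=> s /andP[s0 _]; have dxs := has_mxderive_is_derive (dx s s0).
  exact: (has_mxderiveM (has_mxderiveMr P (has_mxderive_tr dxs)) dxs).
- by move=> s _; exact: closed_loop_lyapunov_le.
Qed.

Lemma closed_loop_decay : exists c : R, 0 < c /\
  forall x : R -> 'cV[R]_n,
    closed_loop_solution A B (- (B^T *m P)) x ->
    forall t : R, 0 <= t ->
      enorm (x t) <= c * expR (- lambda * t) * enorm (x 0).
Proof.
have trQ_ge0 : 0 <= \tr Q.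
  apply: sumr_ge0 => i _; have := Q_ge0 (delta_mx i 0).
  by rewrite trmx_delta -rowE -colE [col _ _ _ _]mxE [row _ _ _ _]mxE.
set C := \tr Q * mxl1 P; have C_ge0 : 0 <= C by rewrite mulr_ge0 ?mxl1_ge0.
(* The estimates give the constant [Num.sqrt C]; the [+ 1] keeps it positive also when [n = 0],
   where [C = 0]. *)
exists (Num.sqrt C + 1); split; first by rewrite ltr_wpDl ?sqrtr_ge0.
move=> x sol t t0; rewrite !enormE.
apply: (@le_trans _ _ (Num.sqrt (C * expR (- lambda * t) ^+ 2 * sqnorm (x 0)))).
  apply: ler_wsqrtr; apply: le_trans (sqnorm_le_form _ Q_unit Q_tr Q_ge0) _.
  rewrite -!mulrA ler_wpM2l//.
  apply: le_trans (closed_loop_form_decay sol t0) _.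
  rewrite [leRHS](_ : _ = expR (- lambda * t) * expR (- lambda * t) *
    (mxl1 P * sqnorm (x 0))); last by ring.
  rewrite -expRD.
  have -> : - lambda * t + - lambda * t = - 2 * lambda * t by ring.
  rewrite ler_wpM2l ?expR_ge0//.
  exact: le_trans (ler_norm _) (normr_quadratic_form_le _ _).
rewrite sqrtrM; last by rewrite mulr_ge0 ?sqr_ge0.
rewrite [Num.sqrt (C * _)]sqrtrM//.
rewrite sqrtr_sqr ger0_norm ?expR_ge0// ler_wpM2r ?sqrtr_ge0//.
by rewrite ler_wpM2r ?expR_ge0// lerDl.
Qed.

End ClosedLoop.

Theorem theorem10p1 (R : realType) (n p : nat)
    (A : 'M[R]_n) (B : 'M[R]_(n, p)) (t0 t1 : R) (lt_t0t1 : t0 < t1)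
    (ctrlAB : controllable A B t0 t1) :
  exists lambda0 : R, 0 < lambda0 /\
    forall lambda : R, lambda0 < lambda ->
      let Q := gramian A B lambda in
      let P := invmx Q in
      [/\ mx_integrable `[0, +oo[ (gramian_integrand A B lambda),
          Q \in unitmx &
          exists c : R, 0 < c /\
            forall x : R -> 'cV[R]_n,
              closed_loop_solution A B (- (B^T *m P)) x ->
              forall t : R, 0 <= t ->
                enorm (x t) <= c * expR (- lambda * t) * enorm (x 0)].
Proof.
(* The estimates rest on [mxl1 A < lambda]; the [+ 1] makes the threshold positive even for
   [A = 0]. *)
exists (mxl1 A + 1); split; first by rewrite ltr_wpDl ?mxl1_ge0.
move=> lambda lambda_gt Q P.
have lambda_large : mxl1 A < lambda by apply: lt_trans lambda_gt; rewrite ltrDl.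
have lyap := gramian_lyapunov B lambda_large.
have Qtr := gramian_tr A B lambda.
have Qu : Q \in unitmx.
  exact: (lyapunov_unitmx lt_t0t1 ctrlAB (erefl _) Qtr lyap).
split=> //; first exact: gramian_integrand_integrable.
by apply: closed_loop_decay => //; exact: gramian_ge0.
Qed.
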